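(* Let $\pi\colon X\to Y$ be a standard cyclic covering of degree $d$ of projective varieties over $k$, with associated line bundle $L$ on $Y$ and branch section $s\in H^0(Y,L^{\otimes d})$, such that $s$ is in the image of the $d$-fold multiplication map $$H^0(Y,L)^{\otimes d}\longrightarrow H^0(Y,L^{\otimes d}).$$ Assume that the branch divisor $B=Z(s)$ is a smooth divisor. Then $L$ is generated by global sections.
   Context: $k$ is an algebraically closed field of characteristic zero; a variety is an integral separated scheme of finite type over $k$. Standard cyclic cover: a ramified cyclic Galois cover $\pi\colon X\to Y$ of degree $d$ (i.e. $Y=X/(\mathbb{Z}/d\mathbb{Z})$ for a faithful action, $\pi$ the quotient map) with $\pi_*\mathcal{O}_X\cong\mathcal{O}_Y\oplus L^{-1}\oplus\cdots\oplus L^{1-d}$ for a line bundle $L$ on $Y$. Its branch divisor is $B=Z(s)$ for a nonzero section $s\in H^0(Y,L^{\otimes d})$, and $X$ is the closed subscheme $\{t^d=s\}$ of the total space of $L$, with $t$ the tautological section of the pullback of $L$. *)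

(* Defs.v *)
(* Schemes over a field, as ringed spaces locally isomorphic to spectra, on top
   of the topological spaces of MathComp-Analysis.

   Schemes that mathematicians construct up to unique isomorphism (P^n, fibre
   products, total spaces of line bundles, zero schemes of sections, ...) are
   not built here but specified by predicates, always together with the
   morphisms and sections that determine them. *)

From HB Require Import structures.
From mathcomp Require Import all_boot all_order all_algebra.
From mathcomp Require Import boolp classical_sets topology.

Set Implicit Arguments.
Unset Strict Implicit.
Unset Printing Implicit Defensive.

Import GRing.Theory.
Local Open Scope classical_set_scope.
Local Open Scope ring_scope.

(** * Commutative algebra *)

(* Rings of sections may be zero (over the empty open set), whence
   [comPzRingType].  A k-algebra is a ring with a structure morphism from k. *)

Record prime_ideal (A : comPzRingType) (P : set A) : Prop := PrimeIdeal {
  prime_ideal0 : P 0;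
  prime_idealD : forall a b, P a -> P b -> P (a + b);
  prime_idealM : forall a b, P b -> P (a * b);
  prime_ideal1 : ~ P 1;
  prime_idealMP : forall a b, P (a * b) -> P a \/ P b }.

Definition generated_algebra (k A : comPzRingType) (st : {rmorphism k -> A})
    (n : nat) (x : 'I_n -> A) : Prop :=
  forall S : set A,
    (forall c, S (st c)) -> (forall i, S (x i)) ->
    (forall a b, S a -> S b -> S (a + b)) ->
    (forall a b, S a -> S b -> S (a * b)) ->
    forall a, S a.

Definition finite_type_algebra (k A : comPzRingType) (st : {rmorphism k -> A}) :
    Prop :=
  exists (n : nat) (x : 'I_n -> A), generated_algebra st x.

(* A is the polynomial algebra on the x i; the morphism g is unique because the
   x i generate. *)
Definition polynomial_algebra (k A : comPzRingType) (st : {rmorphism k -> A})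
    (n : nat) (x : 'I_n -> A) : Prop :=
  generated_algebra st x /\
  forall (C : comPzRingType) (stC : {rmorphism k -> C}) (c : 'I_n -> C),
    exists g : {rmorphism A -> C},
      (forall a, g (st a) = stC a) /\ (forall i, g (x i) = c i).

(* The infinitesimal lifting property of EGA IV 17.1.1 / 0_IV 19.3.1: C -> C'
   is a surjection of k-algebras whose kernel has square zero. *)
Definition formally_smooth (k A : comPzRingType) (st : {rmorphism k -> A}) :
    Prop :=
  forall (C C' : comPzRingType)
    (stC : {rmorphism k -> C}) (stC' : {rmorphism k -> C'})
    (q : {rmorphism C -> C'}) (f : {rmorphism A -> C'}),
    (forall c, q (stC c) = stC' c) ->
    (forall c', exists c, q c = c') ->
    (forall a b, q a = 0 -> q b = 0 -> a * b = 0) ->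
    (forall c, f (st c) = stC' c) ->
    exists g : {rmorphism A -> C},
      (forall c, g (st c) = stC c) /\ (forall a, q (g a) = f a).

(* Smooth means formally smooth and of finite presentation; over a field, finite
   type is the same as finite presentation. *)
Definition smooth_algebra (k : fieldType) (A : comPzRingType)
    (st : {rmorphism k -> A}) : Prop :=
  finite_type_algebra st /\ formally_smooth st.

Definition multilinear (R : pzRingType) (A B : lmodType R) (d : nat)
    (phi : ('I_d -> A) -> B) : Prop :=
  forall (i : 'I_d) (l l1 l2 : 'I_d -> A) (a : R),
    (forall j, j != i -> l1 j = l j /\ l2 j = l j) ->
    l i = a *: l1 i + l2 i ->
    phi l = a *: phi l1 + phi l2.

(** * Ringed spaces *)

(* Allows an open set U to be applied to a point: U x. *)
Identity Coercion set_pred : set >-> Funclass.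

Record opens (T : topologicalType) := Opens {
  oset :> set T;
  oset_open : open oset }.

Definition whole (T : topologicalType) : opens T := Opens (@openT T).

Lemma sub_whole (T : topologicalType) (U : opens T) : U `<=` whole T.
Proof. by []. Qed.

Record ringedSpace (k : fieldType) := RingedSpace {
  space :> topologicalType;
  reg : opens space -> comPzRingType;
  res : forall U V : opens space, V `<=` U -> {rmorphism reg U -> reg V};
  str : forall U : opens space, {rmorphism k -> reg U};
  res_id : forall (U : opens space) (h : U `<=` U) a, res h a = a;
  res_res : forall (U V W : opens space)
    (h : V `<=` U) (h' : W `<=` V) (h'' : W `<=` U) a,
    res h' (res h a) = res h'' a;
  res_str : forall (U V : opens space) (h : V `<=` U) c,
    res h (str U c) = str V c;
  reg_separated : forall (U : opens space) (I : Type) (V : I -> opens space)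
    (h : forall i, V i `<=` U),
    (forall x, U x -> exists i, V i x) ->
    forall a b, (forall i, res (h i) a = res (h i) b) -> a = b;
  reg_glue : forall (U : opens space) (I : Type) (V : I -> opens space)
    (h : forall i, V i `<=` U),
    (forall x, U x -> exists i, V i x) ->
    forall a : (forall i, reg (V i)),
      (forall i j (W : opens space) (hi : W `<=` V i) (hj : W `<=` V j),
        res hi (a i) = res hj (a j)) ->
      exists b, forall i, res (h i) b = a i }.

Section RingedSpaces.
Variables (k : fieldType) (X : ringedSpace k).
Implicit Types (x : X) (U V W : opens X).

(* The germ of a at x is a unit of the stalk. *)
Definition unit_at x U (a : reg U) : Prop :=
  exists V (h : V `<=` U), V x /\ exists b, res h a * b = 1.

Definition nonvanishing_set U (a : reg U) : set X :=
  [set x | U x /\ unit_at x a].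

Lemma nonvanishing_open U (a : reg U) : open (nonvanishing_set a).
Proof.
suff -> : nonvanishing_set a =
    \bigcup_(V in [set V : opens X | exists h : V `<=` U,
                     exists b, res h a * b = 1]) oset V.
  by apply: bigcup_open => V _; exact: oset_open.
apply/seteqP; split => [x [_ [V [h [Vx hb]]]]|x [V [h [b hb]] Vx]].
  by exists V => //; exists h.
by split; [exact: (h x Vx) | exists V, h; split => //; exists b].
Qed.

(* The basic open set D(a). *)
Definition nonvanishing U (a : reg U) : opens X := Opens (nonvanishing_open a).

Lemma nonvanishing_sub U (a : reg U) : nonvanishing a `<=` U.
Proof. by move=> x [Ux _]. Qed.

(* The canonical map U -> Spec A, for A = reg U, sending x to the ideal of the
   a : A whose germ at x is not a unit, is an isomorphism of ringed spaces: it
   is a bijection onto the primes of A, the D(a) form a basis of the topology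
   of U, and reg (D(a)) is the localization A_a. *)
Record affine U : Prop := Affine {
  affine_prime : forall x, U x -> prime_ideal [set a : reg U | ~ unit_at x a];
  affine_inj : forall x y, U x -> U y ->
    [set a : reg U | ~ unit_at x a] = [set a | ~ unit_at y a] -> x = y;
  affine_surj : forall P : set (reg U), prime_ideal P ->
    exists2 x, U x & P = [set a | ~ unit_at x a];
  affine_basis : forall V x, V `<=` U -> V x ->
    exists a : reg U, nonvanishing a x /\ nonvanishing a `<=` V;
  affine_frac : forall (a : reg U) (b : reg (nonvanishing a)),
    exists (n : nat) (c : reg U),
      res (@nonvanishing_sub U a) (a ^+ n) * b = res (@nonvanishing_sub U a) c;
  affine_ker : forall (a c : reg U), res (@nonvanishing_sub U a) c = 0 ->
    exists n : nat, a ^+ n * c = 0 }.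

End RingedSpaces.

Record scheme (k : fieldType) := Scheme {
  rspace :> ringedSpace k;
  locally_affine : forall x : rspace,
    exists U : opens rspace, U x /\ affine U }.

(** * Morphisms of k-schemes *)

Definition preim_opens (S T : topologicalType) (f : S -> T)
    (hf : forall V : set T, open V -> open (f @^-1` V)) (V : opens T) : opens S :=
  Opens (hf V (oset_open V)).

Section Morphisms.
Variable k : fieldType.
Implicit Types X Y Z : scheme k.

Record mor X Y := Mor {
  mor_fun :> X -> Y;
  mor_cont : forall V : set Y, open V -> open (mor_fun @^-1` V);
  mor_pull : forall V : opens Y,
    {rmorphism reg V -> reg (preim_opens mor_cont V)};
  mor_pull_res : forall (V W : opens Y) (h : W `<=` V)
    (h' : preim_opens mor_cont W `<=` preim_opens mor_cont V) a,
    mor_pull W (res h a) = res h' (mor_pull V a);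
  mor_pull_str : forall V c, mor_pull V (str V c) = str _ c;
  mor_pull_local : forall (V : opens Y) (a : reg V) x,
    V (mor_fun x) -> unit_at x (mor_pull V a) -> unit_at (mor_fun x) a }.

Definition mpre X Y (f : mor X Y) (V : opens Y) : opens X :=
  preim_opens (@mor_cont X Y f) V.

Definition pull X Y (f : mor X Y) (V : opens Y) :
  {rmorphism reg V -> reg (mpre f V)} := @mor_pull X Y f V.

Definition mor_eq X Y (f g : mor X Y) : Prop :=
  (forall x, f x = g x) /\
  forall (V : opens Y) (a : reg V) (W : opens X)
    (hf : W `<=` mpre f V) (hg : W `<=` mpre g V),
    res hf (pull f V a) = res hg (pull g V a).

Section Identity.
Variable X : scheme k.

Definition id_cont (V : set X) (h : open V) : open (id @^-1` V) := h.

Lemma id_sub (V : opens X) : preim_opens id_cont V `<=` V.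
Proof. by []. Qed.

Lemma id_pull_res (V W : opens X) (h : W `<=` V)
    (h' : preim_opens id_cont W `<=` preim_opens id_cont V) a :
  res (@id_sub W) (res h a) = res h' (res (@id_sub V) a).
Proof.
have h'' : preim_opens id_cont W `<=` V by move=> x /h'.
by rewrite (res_res _ _ h'') (res_res _ _ h'').
Qed.

Lemma id_pull_local (V : opens X) (a : reg V) x :
  V (id x) -> unit_at x (res (@id_sub V) a) -> unit_at (id x) a.
Proof.
move=> _ [W [h [Wx [b hb]]]].
have h' : W `<=` V by move=> y /h.
by exists W, h'; split => //; exists b; rewrite -hb (res_res _ _ h').
Qed.

Definition mor_id : mor X X :=
  @Mor X X id id_cont (fun V => res (@id_sub V)) id_pull_res
    (fun V c => res_str _ c) id_pull_local.

End Identity.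

Section Composition.
Variables (X Y Z : scheme k) (g : mor Y Z) (f : mor X Y).

Definition comp_cont (V : set Z) (h : open V) : open ((g \o f) @^-1` V) :=
  mor_cont f (mor_cont g h).

Definition comp_pull (V : opens Z) :
    {rmorphism reg V -> reg (preim_opens comp_cont V)} :=
  GRing.RMorphism.clone _ _ (pull f (mpre g V) \o pull g V)%FUN _.

Lemma comp_pull_res (V W : opens Z) (h : W `<=` V)
    (h' : preim_opens comp_cont W `<=` preim_opens comp_cont V) a :
  comp_pull W (res h a) = res h' (comp_pull V a).
Proof.
have hg : mpre g W `<=` mpre g V by move=> y /h.
by rewrite /= [pull g W _](mor_pull_res _ hg) [LHS](mor_pull_res hg h').
Qed.

Lemma comp_pull_str (V : opens Z) c : comp_pull V (str V c) = str _ c.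
Proof. by rewrite /= [pull g V _]mor_pull_str [LHS]mor_pull_str. Qed.

Lemma comp_pull_local (V : opens Z) (a : reg V) x :
  V ((g \o f) x) -> unit_at x (comp_pull V a) -> unit_at ((g \o f) x) a.
Proof. by move=> Vx hu; apply: mor_pull_local => //; apply: mor_pull_local. Qed.

Definition mor_comp : mor X Z :=
  @Mor X Z (g \o f) comp_cont comp_pull comp_pull_res comp_pull_str
    comp_pull_local.

End Composition.

Definition mor_iter X (f : mor X X) (n : nat) : mor X X :=
  iter n (mor_comp f) (mor_id X).

(* A topological closed embedding for which reg Y -> i_* (reg Z) is surjective
   as a morphism of sheaves. *)
Record closed_immersion Z Y (i : mor Z Y) : Prop := ClosedImmersion {
  closed_immersion_inj : injective i;
  closed_immersion_closed : closed (range i);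
  closed_immersion_embed : forall U : opens Z,
    exists V : opens Y, oset U = mpre i V;
  closed_immersion_surj : forall (V : opens Y) (b : reg (mpre i V)) y, V y ->
    exists (W : opens Y) (h' : mpre i W `<=` mpre i V) (a : reg W),
      [/\ W y, W `<=` V & pull i W a = res h' b] }.

(* The restriction to V of the ideal sheaf Ker (reg Y -> i_* (reg Z)) is the
   ideal sheaf generated by f. *)
Definition ideal_generated Z Y (i : mor Z Y) (V : opens Y) (f : reg V) : Prop :=
  forall (W : opens Y) (h : W `<=` V) (a : reg W),
    pull i W a = 0 <->
    forall y, W y -> exists (W' : opens Y) (h' : W' `<=` W) (c : reg W'),
      W' y /\ res h' a = c * res h' (res h f).

(** * Varieties *)

Definition integral_scheme X : Prop :=
  (exists x : X, True) /\
  forall U : opens X, (exists x, U x) ->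
    (1 : reg U) <> 0 /\ forall a b : reg U, a * b = 0 -> a = 0 \/ b = 0.

Definition finite_type X : Prop :=
  exists (n : nat) (U : 'I_n -> opens X),
    (forall x, exists i, U i x) /\
    forall i, affine (U i) /\ finite_type_algebra (str (U i)).

(* (P, p1, p2) is the product of X and Y in the category of k-schemes. *)
Definition is_product X Y P (p1 : mor P X) (p2 : mor P Y) : Prop :=
  forall (T : scheme k) (f : mor T X) (g : mor T Y),
    exists h : mor T P,
      [/\ mor_eq (mor_comp p1 h) f, mor_eq (mor_comp p2 h) g &
        forall h' : mor T P, mor_eq (mor_comp p1 h') f ->
          mor_eq (mor_comp p2 h') g -> mor_eq h' h].

Definition separated X : Prop :=
  exists (P : scheme k) (p1 p2 : mor P X) (delta : mor X P),
    [/\ is_product p1 p2, mor_eq (mor_comp p1 delta) (mor_id X),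
        mor_eq (mor_comp p2 delta) (mor_id X) & closed_immersion delta].

Definition variety X : Prop :=
  [/\ integral_scheme X, separated X & finite_type X].

(* P is P^n, glued from its standard charts U i = {X_i <> 0}; x i j is the
   coordinate X_j / X_i on U i. *)
Definition is_projective_space (n : nat) (P : scheme k) : Prop :=
  exists (U : 'I_n.+1 -> opens P) (x : forall i, 'I_n.+1 -> reg (U i)),
    [/\ forall y, exists i, U i y,
        forall i, affine (U i) /\ x i i = 1,
        forall i, polynomial_algebra (str (U i)) (fun j : 'I_n => x i (lift i j)),
        forall i j, oset (U i) `&` oset (U j) = nonvanishing (x i j) &
        forall i j l (W : opens P) (hi : W `<=` U i) (hj : W `<=` U j),
          res hi (x i l) = res hj (x j l) * res hi (x i j)].

Definition projective X : Prop :=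
  exists (n : nat) (P : scheme k) (i : mor X P),
    is_projective_space n P /\ closed_immersion i.

Definition smooth X : Prop :=
  forall x : X, exists U : opens X,
    [/\ U x, affine U & smooth_algebra (str U)].

End Morphisms.

(** * Line bundles, as invertible sheaves *)

Record modSheaf (k : fieldType) (X : ringedSpace k) := ModSheaf {
  sec : forall U : opens X, lmodType (reg U);
  mres : forall U V : opens X, V `<=` U -> {additive sec U -> sec V};
  mres_scale : forall (U V : opens X) (h : V `<=` U) (a : reg U) (m : sec U),
    mres h (a *: m) = res h a *: mres h m;
  mres_id : forall (U : opens X) (h : U `<=` U) m, mres h m = m;
  mres_mres : forall (U V W : opens X)
    (h : V `<=` U) (h' : W `<=` V) (h'' : W `<=` U) m,
    mres h' (mres h m) = mres h'' m;
  sec_separated : forall (U : opens X) (I : Type) (V : I -> opens X)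
    (h : forall i, V i `<=` U),
    (forall x, U x -> exists i, V i x) ->
    forall m m', (forall i, mres (h i) m = mres (h i) m') -> m = m';
  sec_glue : forall (U : opens X) (I : Type) (V : I -> opens X)
    (h : forall i, V i `<=` U),
    (forall x, U x -> exists i, V i x) ->
    forall m : (forall i, sec (V i)),
      (forall i j (W : opens X) (hi : W `<=` V i) (hj : W `<=` V j),
        mres hi (m i) = mres hj (m j)) ->
      exists m', forall i, mres (h i) m' = m i }.

Arguments mres {k X _ U V} h.

Section LineBundles.
Variables (k : fieldType) (X : ringedSpace k).
Implicit Types (L M : modSheaf X) (U V W : opens X).

(* e trivializes L over V. *)
Definition frame L V (e : sec L V) : Prop :=
  forall W (h : W `<=` V), bijective (fun a : reg W => a *: mres h e).

Definition line_bundle L : Prop :=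
  forall x : X, exists V (e : sec L V), V x /\ frame e.

Definition global_sections L := sec L (whole X).

Definition restrict L U : global_sections L -> sec L U := mres (@sub_whole X U).

(* Every germ of L is a combination of germs of global sections. *)
Definition globally_generated L : Prop :=
  forall (x : X) U (m : sec L U), U x ->
    exists V (h : V `<=` U) (n : nat) (a : 'I_n -> reg V)
      (l : 'I_n -> global_sections L),
      V x /\ mres h m = \sum_(i < n) a i *: restrict V (l i).

Record tensor_map L (d : nat) M := TensorMap {
  tensor_fun :> forall U, ('I_d -> sec L U) -> sec M U;
  tensor_multilinear : forall U, multilinear (@tensor_fun U);
  tensor_mres : forall U V (h : V `<=` U) (l : 'I_d -> sec L U),
    mres h (tensor_fun l) = tensor_fun (fun i => mres h (l i)) }.

(* mu exhibits M as the d-th tensor power of L, that is, as the sheafification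
   of the presheaf U |-> L(U) (x) ... (x) L(U), tensor products over reg U: the
   induced map from that presheaf to M is locally surjective and locally
   injective.  A sum of pure tensors is zero in a tensor product of modules if
   and only if every multilinear map kills it. *)
Definition is_tensor_power L d M (mu : tensor_map L d M) : Prop :=
  (forall U (m : sec M U) x, U x ->
    exists V (h : V `<=` U) (n : nat) (a : 'I_n -> reg V)
      (l : 'I_n -> 'I_d -> sec L V),
      V x /\ mres h m = \sum_(j < n) a j *: mu V (l j)) /\
  (forall U (n : nat) (a : 'I_n -> reg U) (l : 'I_n -> 'I_d -> sec L U),
    \sum_(j < n) a j *: mu U (l j) = 0 ->
    forall x, U x -> exists V (h : V `<=` U), V x /\
      forall (N : lmodType (reg V)) (phi : ('I_d -> sec L V) -> N),
        multilinear phi ->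
        \sum_(j < n) res h (a j) *: phi (fun i => mres h (l j i)) = 0).

(* The image of the multiplication map from the d-th tensor power over k of
   H^0(X, L) to H^0(X, M). *)
Definition in_mult_image L d M (mu : tensor_map L d M) (s : global_sections M) :
    Prop :=
  exists (n : nat) (c : 'I_n -> k) (l : 'I_n -> 'I_d -> global_sections L),
    s = \sum_(j < n) str (whole X) (c j) *: mu (whole X) (l j).

(* Sections over U of L^{-i}, the dual of the i-th tensor power of L. *)
Record dual_power L (i : nat) U := DualPower {
  dual_fun : forall V, V `<=` U -> ('I_i -> sec L V) -> (reg V)^o;
  dual_multilinear : forall V (h : V `<=` U), multilinear (dual_fun h);
  dual_res : forall V W (h : V `<=` U) (h' : W `<=` V) (h'' : W `<=` U)
    (l : 'I_i -> sec L V),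
    res h' (dual_fun h l) = dual_fun h'' (fun j => mres h' (l j)) }.

Definition dual_eq L i U (u v : dual_power L i U) : Prop :=
  forall V (h : V `<=` U) (l : 'I_i -> sec L V), dual_fun u h l = dual_fun v h l.

End LineBundles.

(** * Standard cyclic covers *)

Section CyclicCovers.
Variable k : fieldType.
Implicit Types X Y T : scheme k.

(* i : B -> Y is the closed subscheme Z(s): where s = f m for a frame m of M,
   its ideal is generated by f. *)
Definition is_zero_scheme Y (M : modSheaf Y) (s : global_sections M)
    B (i : mor B Y) : Prop :=
  closed_immersion i /\
  forall (V : opens Y) (m : sec M V) (f : reg V),
    frame m -> restrict V s = f *: m -> ideal_generated i f.

(* p : T -> Y is the total space of L, and t its tautological section of p^*L:
   over V, this section is t V e * p^*(e) for any frame e of L, and T is the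
   affine line with coordinate t V e. *)
Record is_total_space Y (L : modSheaf Y) T (p : mor T Y)
    (t : forall V : opens Y, sec L V -> reg (mpre p V)) : Prop := IsTotalSpace {
  total_res : forall (V W : opens Y) (h : W `<=` V)
    (h' : mpre p W `<=` mpre p V) (e : sec L V), frame e ->
    t W (mres h e) = res h' (t V e);
  total_change : forall (V : opens Y) (e : sec L V) (u : reg V),
    frame e -> frame (u *: e) -> t V e = t V (u *: e) * pull p V u;
  total_affine : forall V : opens Y, affine V -> affine (mpre p V);
  total_span : forall (V : opens Y) (e : sec L V), affine V -> frame e ->
    forall b : reg (mpre p V), exists (n : nat) (a : 'I_n -> reg V),
      b = \sum_(i < n) pull p V (a i) * t V e ^+ i;
  total_free : forall (V : opens Y) (e : sec L V), affine V -> frame e ->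
    forall (n : nat) (a : 'I_n -> reg V),
      \sum_(i < n) pull p V (a i) * t V e ^+ i = 0 -> forall i, a i = 0 }.

(* X, over Y through pi, is the closed subscheme {t^d = s} of the total space
   of L. *)
Definition is_root_cover (d : nat) X Y (pi : mor X Y) (L M : modSheaf Y)
    (mu : tensor_map L d M) (s : global_sections M) : Prop :=
  exists (T : scheme k) (p : mor T Y)
    (t : forall V : opens Y, sec L V -> reg (mpre p V)) (j : mor X T),
    [/\ is_total_space t, closed_immersion j, mor_eq (mor_comp p j) pi &
      forall (V : opens Y) (e : sec L V) (f : reg V), frame e ->
        restrict V s = f *: mu V (fun=> e) ->
        ideal_generated j (t V e ^+ d - pull p V f)].

(* sigma generates a faithful action of Z/d on X over k. *)
Definition faithful_cyclic_action (d : nat) X (sigma : mor X X) : Prop :=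
  mor_eq (mor_iter sigma d) (mor_id X) /\
  forall i, (0 < i < d)%N -> ~ mor_eq (mor_iter sigma i) (mor_id X).

(* Y is the quotient of X by the group generated by sigma: as a topological
   space it is the orbit space, and its functions are the invariant functions
   on X. *)
Record is_quotient X Y (pi : mor X Y) (sigma : mor X X) : Prop := IsQuotient {
  quotient_invariant : mor_eq (mor_comp pi sigma) pi;
  quotient_surj : forall y, exists x, pi x = y;
  quotient_orbit : forall x x', pi x = pi x' ->
    exists i, x' = mor_iter sigma i x;
  quotient_topology : forall V : set Y, open (pi @^-1` V) -> open V;
  quotient_inj : forall V : opens Y, injective (pull pi V);
  quotient_fun : forall (V : opens Y) (b : reg (mpre pi V)),
    (forall (W : opens X) (h : W `<=` mpre pi V)
       (h' : W `<=` mpre sigma (mpre pi V)),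
       res h b = res h' (pull sigma (mpre pi V) b)) ->
    exists a, pull pi V a = b }.

(* The inertia group of x, that is, the group of elements that fix x and act
   trivially on its residue field, contains g. *)
Definition in_inertia X (g : mor X X) (x : X) : Prop :=
  g x = x /\
  forall (U W : opens X) (h : W `<=` U) (h' : W `<=` mpre g U) (a : reg U),
    W x -> ~ unit_at x (res h' (pull g U a) - res h a).

Definition ramified_action (d : nat) X (sigma : mor X X) : Prop :=
  exists (x : X) (i : nat), (0 < i < d)%N /\ in_inertia (mor_iter sigma i) x.

(* An isomorphism of sheaves of modules on Y between the direct sum of the
   L^{-i}, 0 <= i < d, and pi_* (reg X). *)
Definition pushforward_splits (d : nat) X Y (pi : mor X Y) (L : modSheaf Y) :
    Prop :=
  exists psi : forall (i : 'I_d) (V : opens Y),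
      dual_power L i V -> reg (mpre pi V),
    [/\ forall (i : 'I_d) (V : opens Y) (a : reg V) (u v w : dual_power L i V),
          (forall (W : opens Y) (h : W `<=` V) l,
            dual_fun w h l = res h a * dual_fun u h l + dual_fun v h l) ->
          psi i V w = pull pi V a * psi i V u + psi i V v,
        forall (i : 'I_d) (V W : opens Y) (h : W `<=` V)
          (h' : mpre pi W `<=` mpre pi V)
          (u : dual_power L i V) (v : dual_power L i W),
          (forall (W' : opens Y) (g : W' `<=` V) (g' : W' `<=` W) l,
            dual_fun v g' l = dual_fun u g l) ->
          psi i W v = res h' (psi i V u),
        forall (V : opens Y) (b : reg (mpre pi V)),
          exists u : forall i : 'I_d, dual_power L i V,
            b = \sum_(i < d) psi i V (u i) &
        forall (V : opens Y) (u v : forall i : 'I_d, dual_power L i V),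
          \sum_(i < d) psi i V (u i) = \sum_(i < d) psi i V (v i) ->
          forall i, dual_eq (u i) (v i)].

Definition standard_cyclic_cover (d : nat) X Y (pi : mor X Y)
    (L M : modSheaf Y) (mu : tensor_map L d M) (s : global_sections M) : Prop :=
  [/\ exists sigma : mor X X,
        [/\ faithful_cyclic_action d sigma, is_quotient pi sigma &
            ramified_action d sigma],
      pushforward_splits d pi L,
      s <> 0 &
      is_root_cover pi mu s].

End CyclicCovers.

(* Main.v *)
(* If all global sections of L vanish at y, then in a local frame s is given by
   a function f in the d-th power of the maximal ideal m of O_Y,y, hence in m^2
   since d >= 2 by ramification.  Write f = sum_j a_j c_j with a_j, c_j in m.
   Then y lies on B, and the smoothness of B lifts O_B,y = O_Y,y / f to a section
   g of O_Y,y / f^2 -> O_Y,y / f.  As g (a_j) = a_j + f u_j and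
   g (c_j) = c_j + f v_j, the equation 0 = g (f) reads f (1 + eps) = 0 modulo f^2
   with eps in m.  So f is a multiple of f^2 and vanishes near y, and s = 0 because
   Y is integral. *)

From HB Require Import structures.
Require Import Defs.
From mathcomp Require Import all_boot all_order all_algebra.
From mathcomp Require Import generic_quotient ring boolp classical_sets topology.

Set Implicit Arguments.
Unset Strict Implicit.
Unset Printing Implicit Defensive.

Import GRing.Theory.
Local Open Scope ring_scope.
Local Open Scope classical_set_scope.

(** * Choice, invertible elements and square-zero extensions *)

Lemma all_exists (I : Type) (T : I -> Type) (P : forall p, T p -> Prop) :
  (forall p, exists t, P p t) -> exists f : forall p, T p, forall p, P p (f p).
Proof.
by move=> exT; exists (fun p => sval (cid (exT p))) => p; case: cid.
Qed.

Definition invertible (R : comPzRingType) (x : R) : Prop := exists z, x * z = 1.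

Lemma invertible_exp (R : comPzRingType) (x : R) n :
  invertible x -> invertible (x ^+ n).
Proof. by move=> [z xz]; exists (z ^+ n); rewrite -exprMn xz expr1n. Qed.

Lemma invertible_cancel (R : comPzRingType) (x y : R) :
  invertible x -> x * y = 0 -> y = 0.
Proof.
by move=> [z xz] xy0; rewrite -[y]mul1r -xz (mulrC x) -mulrA xy0 mulr0.
Qed.

(** A lift [z] of the inverse gives [x * z = 1 + eps] with [eps] of square zero, and [1 - eps]
    inverts [1 + eps]. *)
Lemma invertible_lift (C C' : comPzRingType) (q : {rmorphism C -> C'}) (x : C) :
  (forall c', exists c, q c = c') ->
  (forall a b, q a = 0 -> q b = 0 -> a * b = 0) ->
  invertible (q x) -> invertible x.
Proof.
move=> q_surj q_sq [z' xz']; have [z qz] := q_surj z'.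
have q0 : q (x * z - 1) = 0 by rewrite rmorphB rmorphM qz xz' rmorph1 subrr.
have sq0 := q_sq _ _ q0 q0; exists (z * (1 - (x * z - 1))).
by transitivity (1 - (x * z - 1) * (x * z - 1)); [ring | rewrite sq0 subr0].
Qed.

(** The algebraic core, with [F] standing for the class of [f] modulo its square. Smoothness
    concerns the ring [S] of an affine open of [B], not a stalk, so the local functions enter only
    through numerators [alpha], [gamma] over the denominator [h ^+ N]. Applying [g] to the vanishing
    sum turns it into an invertible multiple of [F]. *)
Lemma square_zero_lift (C S : comPzRingType) (g : {rmorphism S -> C}) (F : C)
    (n : nat) (a c : 'I_n -> C) (alpha gamma : 'I_n -> S) (h : S) (N p : nat) :
  (forall x y : C, invertible (x + y) -> invertible x \/ invertible y) ->
  ~ invertible (0 : C) ->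
  F * F = 0 -> F = \sum_j a j * c j ->
  (forall j, ~ invertible (a j)) -> (forall j, ~ invertible (c j)) ->
  invertible (g h) ->
  (forall j, exists e, g (alpha j) = g h ^+ N * a j + e * F) ->
  (forall j, exists e, g (gamma j) = g h ^+ N * c j + e * F) ->
  h ^+ p * \sum_j alpha j * gamma j = 0 -> F = 0.
Proof.
move=> localC C0 FF Fac na nc uh /fin_all_exists [e he] /fin_all_exists [e' he'].
move=> /(congr1 g); rewrite rmorphM rmorphXn rmorph_sum rmorph0.
move=> /(invertible_cancel (invertible_exp p uh)).
pose H := g h ^+ N; pose M := \sum_j H * (a j * e' j + e j * c j).
have -> : \sum_j g (alpha j * gamma j) = (H * H + M) * F.
  (* The three terms are the orders 0, 1 and 2 in the error [F]; the first sums to [H * H * F] and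
     the last dies because [F * F = 0]. *)
  transitivity (\sum_j (H * H * (a j * c j) +
      H * (a j * e' j + e j * c j) * F + e j * e' j * (F * F))).
    by apply: eq_bigr => j _; rewrite rmorphM he he' -/H; ring.
  rewrite !big_split /= -big_distrr -Fac -big_distrl -/M mulrDl.
  by rewrite [X in _ + X]big1 ?addr0 // => j _; rewrite FF mulr0.
have uH : invertible (H * H) by rewrite -expr2; do 2 apply: invertible_exp.
(* In a local ring a unit plus a nonunit is a unit. [M] is a nonunit because each of its terms has a
   factor [a j] or [c j]. *)
suff nM : ~ invertible M.
  by apply: invertible_cancel; case: (localC (H * H + M) (- M)) => [|//|[z zM]];
    [rewrite addrK | case: nM; exists (- z); rewrite mulrN -mulNr].
have invM (x y : C) : invertible (x * y) -> invertible x /\ invertible y.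
  move=> [z xyz]; split; first by exists (y * z); rewrite mulrA.
  by exists (x * z); rewrite mulrCA mulrA.
rewrite /M; elim/big_ind: _ => [//|x y nx ny /localC [] //|j _].
by move=> /invM [_ /localC [] /invM []] => [/na | _ /nc].
Qed.

(** * Germs *)

Definition capo (T : topologicalType) (U V : opens T) : opens T :=
  Opens (openI (oset_open U) (oset_open V)).

Lemma capl (T : topologicalType) (U V : opens T) : capo U V `<=` U.
Proof. by move=> x []. Qed.

Lemma capr (T : topologicalType) (U V : opens T) : capo U V `<=` V.
Proof. by move=> x []. Qed.

Section Restrictions.
Variables (k : fieldType) (Y : ringedSpace k).
Implicit Types (U V W : opens Y) (x y : Y).

Lemma res_comp U V W (h : V `<=` U) (h' : W `<=` V) (a : reg U) :
  res h' (res h a) = res (subset_trans h' h) a.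
Proof. exact: res_res. Qed.

Lemma res_irr U V (h h' : V `<=` U) (a : reg U) : res h a = res h' a.
Proof. by rewrite (Prop_irrelevance h h'). Qed.

Lemma unit_at_res U V (h : V `<=` U) y (a : reg U) : V y ->
  unit_at y (res h a) <-> unit_at y a.
Proof.
move=> Vy; split=> [[Z [hZ [Zy [b hb]]]]|[Z [hZ [Zy [b hb]]]]].
  exists Z, (subset_trans hZ h); split=> //; exists b.
  by rewrite -res_comp.
pose Z' := capo Z V; have hV : Z' `<=` V by move=> ? [].
have hZ' : Z' `<=` Z by move=> ? [].
exists Z', hV; split; first by split.
exists (res hZ' b); rewrite -(rmorph1 (res hZ')) -hb rmorphM !res_comp.
by congr (_ * _); apply: res_irr.
Qed.

Lemma unit_atM U y (a b : reg U) :
  unit_at y (a * b) <-> unit_at y a /\ unit_at y b.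
Proof.
split=> [[Z [hZ [Zy [c hc]]]]|[[Z [hZ [Zy [c hc]]]] [Z' [hZ' [Zy' [c' hc']]]]]].
  split; exists Z, hZ; split=> //.
    by exists (res hZ b * c); rewrite mulrA -rmorphM.
  by exists (res hZ a * c); rewrite mulrA -rmorphM mulrC (mulrC b) mulrC.
pose W := capo Z Z'.
have h : W `<=` Z by move=> ? [].
have h' : W `<=` Z' by move=> ? [].
exists W, (subset_trans h hZ); split; first by split.
exists (res h c * res h' c').
have /(congr1 (res h)) := hc; have /(congr1 (res h')) := hc'.
rewrite !rmorphM !rmorph1 !res_comp.
rewrite (res_irr (subset_trans h' hZ') (subset_trans h hZ)) => e1 e2.
by rewrite mulrACA e1 e2 mulr1.
Qed.

Lemma unit_at1 U y : U y -> unit_at y (1 : reg U).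
Proof.
by move=> Uy; exists U, (@subset_refl _ U); split=> //; exists 1; rewrite rmorph1 mulr1.
Qed.

Lemma unit_at_exp U y (a : reg U) n : U y -> unit_at y a -> unit_at y (a ^+ n).
Proof.
move=> Uy ua; elim: n => [|n IH]; first by rewrite expr0; apply: unit_at1.
by rewrite exprS; apply/unit_atM.
Qed.

End Restrictions.

(* The stalk at y of the structure sheaf, modulo the ideal generated by g. *)
Section StalkMod.
Variables (k : fieldType) (Y : ringedSpace k) (y : Y).
Variables (G : opens Y) (g : reg G) (Gy : G y).
Implicit Types (V W Z : opens Y).

Record presection := Presection {
  predom : opens Y;
  predom_pt : predom y;
  preval : reg predom }.

HB.instance Definition _ := gen_eqMixin presection.
HB.instance Definition _ := gen_choiceMixin presection.

(** With [g = 0] this is the usual equality of germs, which is how the plain stalk of [B] is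
    obtained later. *)
Definition germ_rel (p q : presection) : Prop :=
  exists (Z : opens Y) (hp : Z `<=` predom p) (hq : Z `<=` predom q)
    (hg : Z `<=` G) (c : reg Z),
    Z y /\ res hp (preval p) = res hq (preval q) + c * res hg g.

Definition germ_eqv : rel presection := fun p q => `[< germ_rel p q >].

Lemma germ_eqv_refl : reflexive germ_eqv.
Proof.
move=> p; apply/asboolP; pose Z := capo (predom p) G.
have hp : Z `<=` predom p by move=> ? [].
have hg : Z `<=` G by move=> ? [].
exists Z, hp, hp, hg, 0; split; last by rewrite mul0r addr0.
by split=> //; apply: predom_pt.
Qed.

Lemma germ_eqv_sym : symmetric germ_eqv.
Proof.
suff sub p q : germ_eqv p q -> germ_eqv q p.
  by move=> p q; apply/idP/idP; apply: sub.
move=> /asboolP [Z [hp [hq [hg [c [Zy e]]]]]]; apply/asboolP.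
by exists Z, hq, hp, hg, (- c); split=> //; rewrite e mulNr addrK.
Qed.

Lemma germ_eqv_trans : transitive germ_eqv.
Proof.
move=> q p r /asboolP [Z [hp [hq [hg [c [Zy e]]]]]].
move=> /asboolP [Z' [hq' [hr [hg' [c' [Zy' e']]]]]]; apply/asboolP.
pose W := capo Z Z'.
have h : W `<=` Z by move=> ? [].
have h' : W `<=` Z' by move=> ? [].
exists W, (subset_trans h hp), (subset_trans h' hr), (subset_trans h hg).
exists (res h c + res h' c'); split; first by split.
have := congr1 (res h) e; have := congr1 (res h') e'.
rewrite !rmorphD !rmorphM !res_comp => e1 e2.
rewrite e2 (res_irr (subset_trans h hq) (subset_trans h' hq')) e1.
by rewrite (res_irr (subset_trans h' hg') (subset_trans h hg)) mulrDl; ring.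
Qed.

Canonical germ_equiv :=
  EquivRel germ_eqv germ_eqv_refl germ_eqv_sym germ_eqv_trans.

Definition stalk_mod : Type := {eq_quot germ_eqv}%qT.
HB.instance Definition _ := Choice.on stalk_mod.
HB.instance Definition _ := EqQuotient.on stalk_mod.

Definition germ V (Vy : V y) (a : reg V) : stalk_mod :=
  (\pi_stalk_mod (Presection Vy a))%qT.

Lemma germ_eqP V W (Vy : V y) (Wy : W y) (a : reg V) (b : reg W) :
  germ Vy a = germ Wy b <->
  exists Z (hV : Z `<=` V) (hW : Z `<=` W) (hG : Z `<=` G) (c : reg Z),
    Z y /\ res hV a = res hW b + c * res hG g.
Proof.
split; first by move=> /eqmodP /asboolP.
by move=> e; apply/eqmodP/asboolP.
Qed.

Lemma germP (x : stalk_mod) : exists V (Vy : V y) (a : reg V), x = germ Vy a.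
Proof.
by elim/quotP: x => -[V Vy a] _; exists V, Vy, a.
Qed.

Lemma germ_res V W (h : W `<=` V) (Vy : V y) (Wy : W y) (a : reg V) :
  germ Wy (res h a) = germ Vy a.
Proof.
apply/germ_eqP; pose Z := capo W G.
have hW : Z `<=` W by move=> ? [].
have hg : Z `<=` G by move=> ? [].
exists Z, hW, (subset_trans hW h), hg, 0; split=> //.
by rewrite res_comp mul0r addr0.
Qed.

(** Common domains reduce the ring axioms of the stalk to those of a single ring of sections. *)
Lemma germP2 (x x' : stalk_mod) : exists V (Vy : V y) (a a' : reg V),
  x = germ Vy a /\ x' = germ Vy a'.
Proof.
have [V [Vy [a ->]]] := germP x; have [W [Wy [b ->]]] := germP x'.
have h : capo V W `<=` V by move=> ? [].
have h' : capo V W `<=` W by move=> ? [].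
have Cy : capo V W y by split.
by exists (capo V W), Cy, (res h a), (res h' b); rewrite !germ_res.
Qed.

Lemma germP3 (x x' x'' : stalk_mod) : exists V (Vy : V y) (a a' a'' : reg V),
  [/\ x = germ Vy a, x' = germ Vy a' & x'' = germ Vy a''].
Proof.
have [V [Vy [a [a' [-> ->]]]]] := germP2 x x'; have [W [Wy [b ->]]] := germP x''.
have h : capo V W `<=` V by move=> ? [].
have h' : capo V W `<=` W by move=> ? [].
have Cy : capo V W y by split.
by exists (capo V W), Cy, (res h a), (res h a'), (res h' b); rewrite !germ_res.
Qed.

Definition germ_zero : stalk_mod := germ Gy 0.
Definition germ_one : stalk_mod := germ Gy 1.
Definition germ_opp (x : stalk_mod) : stalk_mod :=
  germ (predom_pt (repr x)) (- preval (repr x)).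

Definition germ_op2 (op : forall V, reg V -> reg V -> reg V)
    (x x' : stalk_mod) : stalk_mod :=
  let V := predom (repr x) in let W := predom (repr x') in
  @germ (capo V W) (conj (predom_pt (repr x)) (predom_pt (repr x')))
    (op _ (res (@capl _ V W) (preval (repr x)))
          (res (@capr _ V W) (preval (repr x')))).

Definition germ_add := germ_op2 (fun _ => +%R).
Definition germ_mul := germ_op2 (fun _ => *%R).

Lemma germ_repr (x : stalk_mod) : germ (predom_pt (repr x)) (preval (repr x)) = x.
Proof. by rewrite /germ -[RHS]reprK; case: (repr x). Qed.

Lemma germ_oppE V (Vy : V y) a : germ_opp (germ Vy a) = germ Vy (- a).
Proof.
have /germ_eqP [Z [h [h' [hg [c [Zy e]]]]]] := germ_repr (germ Vy a).
apply/germ_eqP; exists Z, h, h', hg, (- c); split=> //.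
by rewrite !rmorphN e opprD mulNr.
Qed.

(** Independence of the chosen representatives, for sum and product at once: over a small
    neighbourhood they change by multiples of [g], and the second condition on [op] absorbs such
    changes. *)
Lemma germ_op2E (op : forall V, reg V -> reg V -> reg V) :
  (forall V W (h : W `<=` V) a b, res h (op V a b) = op W (res h a) (res h b)) ->
  (forall V (a b c c' z : reg V), exists e,
     op V (a + c * z) (b + c' * z) = op V a b + e * z) ->
  forall V (Vy : V y) a b, germ_op2 op (germ Vy a) (germ Vy b) = germ Vy (op V a b).
Proof.
move=> op_res op_mod V Vy a b.
have /germ_eqP [Z [h1 [h2 [hg [c [Zy e]]]]]] := germ_repr (germ Vy a).
have /germ_eqP [Z' [h1' [h2' [hg' [c' [Zy' e']]]]]] := germ_repr (germ Vy b).
pose W := capo Z Z'.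
have h : W `<=` Z by move=> ? [].
have h' : W `<=` Z' by move=> ? [].
have hW : W `<=` capo (predom (repr (germ Vy a))) (predom (repr (germ Vy b))).
  by move=> x [Zx Z'x]; exact: (conj (h1 x Zx) (h1' x Z'x)).
apply/germ_eqP.
have [d ed] := op_mod W (res (subset_trans h h2) a) (res (subset_trans h h2) b)
  (res h c) (res h' c') (res (subset_trans h hg) g).
exists W, hW, (subset_trans h h2), (subset_trans h hg), d; split; first by split.
rewrite !op_res !res_comp -{}ed; congr (op W _ _).
  have := congr1 (res h) e; rewrite rmorphD rmorphM !res_comp => <-.
  exact: res_irr.
have := congr1 (res h') e'; rewrite rmorphD rmorphM !res_comp.
rewrite (res_irr (subset_trans h' h2') (subset_trans h h2)).
rewrite (res_irr (subset_trans h' hg') (subset_trans h hg)) => <-.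
exact: res_irr.
Qed.

Lemma germ_addE V (Vy : V y) a b :
  germ_add (germ Vy a) (germ Vy b) = germ Vy (a + b).
Proof.
apply: germ_op2E => [*|W a' b' c c' z]; first exact: rmorphD.
by exists (c + c'); ring.
Qed.

Lemma germ_mulE V (Vy : V y) a b :
  germ_mul (germ Vy a) (germ Vy b) = germ Vy (a * b).
Proof.
apply: germ_op2E => [*|W a' b' c c' z]; first exact: rmorphM.
by exists (a' * c' + c * b' + c * c' * z); ring.
Qed.

Lemma germ_zeroE V (Vy : V y) : germ_zero = germ Vy 0.
Proof.
have h : capo V G `<=` V by move=> ? [].
have h' : capo V G `<=` G by move=> ? [].
have Cy : capo V G y by split.
by rewrite /germ_zero -(germ_res h' _ Cy) -(germ_res h _ Cy) !rmorph0.
Qed.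

Lemma germ_oneE V (Vy : V y) : germ_one = germ Vy 1.
Proof.
have h : capo V G `<=` V by move=> ? [].
have h' : capo V G `<=` G by move=> ? [].
have Cy : capo V G y by split.
by rewrite /germ_one -(germ_res h' _ Cy) -(germ_res h _ Cy) !rmorph1.
Qed.

Definition germE := (germ_addE, germ_mulE, germ_oppE).

Fact germ_addA : associative germ_add.
Proof.
by move=> x1 x2 x3; have [V [Vy [a [b [c [-> -> ->]]]]]] := germP3 x1 x2 x3;
  rewrite !germE addrA.
Qed.

Fact germ_addC : commutative germ_add.
Proof.
by move=> x1 x2; have [V [Vy [a [b [-> ->]]]]] := germP2 x1 x2;
  rewrite !germE addrC.
Qed.

Fact germ_add0 : left_id germ_zero germ_add.
Proof.
by move=> x; have [V [Vy [a ->]]] := germP x; rewrite (germ_zeroE Vy) !germE add0r.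
Qed.

Fact germ_addN : left_inverse germ_zero germ_opp germ_add.
Proof.
by move=> x; have [V [Vy [a ->]]] := germP x; rewrite (germ_zeroE Vy) !germE addNr.
Qed.

HB.instance Definition _ :=
  GRing.isZmodule.Build stalk_mod germ_addA germ_addC germ_add0 germ_addN.

Fact germ_mulA : associative germ_mul.
Proof.
by move=> x1 x2 x3; have [V [Vy [a [b [c [-> -> ->]]]]]] := germP3 x1 x2 x3;
  rewrite !germE mulrA.
Qed.

Fact germ_mulC : commutative germ_mul.
Proof.
by move=> x1 x2; have [V [Vy [a [b [-> ->]]]]] := germP2 x1 x2;
  rewrite !germE mulrC.
Qed.

Fact germ_mul1 : left_id germ_one germ_mul.
Proof.
by move=> x; have [V [Vy [a ->]]] := germP x; rewrite (germ_oneE Vy) !germE mul1r.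
Qed.

Fact germ_mulD : left_distributive germ_mul germ_add.
Proof.
by move=> x1 x2 x3; have [V [Vy [a [b [c [-> -> ->]]]]]] := germP3 x1 x2 x3;
  rewrite !germE mulrDl.
Qed.

HB.instance Definition _ := GRing.Zmodule_isComPzRing.Build stalk_mod
  germ_mulA germ_mulC germ_mul1 germ_mulD.

Section GermMorphism.
Variables (V : opens Y) (Vy : V y).

Fact germ_is_zmod : zmod_morphism (germ Vy).
Proof. by move=> a b; rewrite -germ_addE -germ_oppE. Qed.

Fact germ_is_monoid : monoid_morphism (germ Vy).
Proof. by split=> [|a b]; [rewrite -germ_oneE | rewrite -germ_mulE]. Qed.

HB.instance Definition _ :=
  GRing.isZmodMorphism.Build (reg V) stalk_mod (germ Vy) germ_is_zmod.
HB.instance Definition _ :=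
  GRing.isMonoidMorphism.Build (reg V) stalk_mod (germ Vy) germ_is_monoid.

End GermMorphism.

Lemma germ_str V W (Vy : V y) (Wy : W y) (c : k) :
  germ Vy (str V c) = germ Wy (str W c).
Proof.
have Cy : capo V W y by split.
by rewrite -(germ_res (@capl _ V W) _ Cy) -(germ_res (@capr _ V W) _ Cy) !res_str.
Qed.

End StalkMod.

(** * Stalks and integrality of schemes *)

Section Stalks.
Variables (k : fieldType) (Y : scheme k).
Implicit Types (U V W : opens Y) (x y : Y).

(** This stands in for the description of a stalk as a localization of [reg W]: finitely many germs
    at [y] receive a common denominator. *)
Lemma affine_fractions U W y (I : finType) (a : I -> reg U) : affine W -> W y -> U y ->
  exists (h : reg W) (hU : nonvanishing h `<=` U) (N : nat) (c : I -> reg W),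
    unit_at y h /\
    forall j, res (@nonvanishing_sub _ _ W h) (h ^+ N) * res hU (a j) =
      res (@nonvanishing_sub _ _ W h) (c j).
Proof.
move=> affW Wy Uy.
have [h [[_ uh] hCap]] := affine_basis affW (@capr _ U W) (conj Uy Wy).
have hU : nonvanishing h `<=` U := subset_trans hCap (@capl _ U W).
have /fin_all_exists [m hm] : forall j : I, exists m (c : reg W),
    res (@nonvanishing_sub _ _ W h) (h ^+ m) * res hU (a j) =
      res (@nonvanishing_sub _ _ W h) c.
  by move=> j; apply: affine_frac.
have /fin_all_exists [c hc] := hm.
(* The sum bounds every exponent [m j]; the missing powers of [h] go into the numerators. *)
pose N := (\sum_j m j)%N.
exists h, hU, N, (fun j => h ^+ (N - m j) * c j); split=> // j.
have leN : (m j <= N)%N by rewrite /N (bigD1 j) //= leq_addr.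
by rewrite rmorphM -hc mulrA -rmorphM -exprD subnK.
Qed.

(** Stalks are local: clearing denominators moves both sections to an affine neighbourhood of [y],
    where the nonunits at [y] form an ideal. *)
Lemma unit_atD U y (a b : reg U) : U y ->
  unit_at y (a + b) -> unit_at y a \/ unit_at y b.
Proof.
move=> Uy uab; have [W [Wy affW]] := locally_affine y.
have [h [hU [N [c [uh hc]]]]] :=
  affine_fractions (fun j : 'I_2 => if j == ord0 then a else b) affW Wy Uy.
have Dy : nonvanishing h y by split.
have hca := hc ord0; have hcb := hc ord_max; rewrite /= in hca hcb.
have [_ pD _ _ _] := affine_prime affW Wy.
apply: contrapT => /not_orP [na nb].
have nu t (e : reg U) : ~ unit_at y e ->
    res (@nonvanishing_sub _ _ W h) (h ^+ N) * res hU e =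
      res (@nonvanishing_sub _ _ W h) t -> ~ unit_at y t.
  move=> ne ht ut; apply: ne; apply/(unit_at_res hU _ Dy).
  by have /unit_atM [] : unit_at y (res (@nonvanishing_sub _ _ W h) (h ^+ N) * res hU e)
    by rewrite ht unit_at_res.
apply: (pD _ _ (nu _ _ na hca) (nu _ _ nb hcb)).
rewrite -(unit_at_res (@nonvanishing_sub _ _ W h) _ Dy) rmorphD -hca -hcb -mulrDr -rmorphD.
by apply/unit_atM; rewrite !unit_at_res //; split=> //; apply: unit_at_exp.
Qed.

Lemma unit_at0 U y : U y -> ~ unit_at y (0 : reg U).
Proof.
move=> Uy; have [W [Wy affW]] := locally_affine y.
have Cy : capo U W y by split.
have [p0 _ _ _ _] := affine_prime affW Wy.
rewrite -(unit_at_res (@capl _ U W) _ Cy) rmorph0.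
by rewrite -(rmorph0 (res (@capr _ U W))) unit_at_res.
Qed.

Lemma unit_at_sum U y n (a : 'I_n -> reg U) : U y ->
  unit_at y (\sum_j a j) -> exists j, unit_at y (a j).
Proof.
move=> Uy; apply: contraPP => /forallNP na.
elim/big_ind: _ => [|b c nb nc /(unit_atD Uy) []|j _] //; exact: unit_at0.
Qed.

Section StalkModUnits.
Variables (y : Y) (G : opens Y) (g : reg G) (Gy : G y).
Hypothesis g_nonunit : ~ unit_at y g.

(** An inverse modulo [g] only gives a product [1 + c * g]; since [g] is a nonunit and the stalk is
    local, this product is still a unit. *)
Lemma germ_invertible V (Vy : V y) (a : reg V) :
  (invertible (germ g Gy Vy a)) <-> unit_at y a.
Proof.
split=> [[z]|[Z [h [Zy [b hb]]]]]; last first.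
  by exists (germ g Gy Zy b); rewrite -(germ_res _ _ h _ Zy) -rmorphM hb rmorph1.
have [W [Wy [b ->]]] := germP z; have Cy : capo V W y by split.
rewrite -(germ_res _ _ (@capl _ V W) _ Cy).
rewrite -(germ_res _ _ (@capr _ V W) _ Cy) -rmorphM.
rewrite -(rmorph1 (germ g Gy Cy)) => /germ_eqP [Z [h [h' [hg [c [Zy]]]]]].
rewrite rmorphM rmorph1 !res_comp => e.
have /unit_atD : unit_at y (res (subset_trans h (@capl _ V W)) a *
    res (subset_trans h (@capr _ V W)) b + - c * res hg g).
  by rewrite e mulNr addrK; apply: unit_at1.
by case=> // /unit_atM []; rewrite !unit_at_res.
Qed.

Lemma stalk_mod_local (x x' : stalk_mod g Gy) :
  invertible (x + x') -> invertible x \/ invertible x'.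
Proof.
have [V [Vy [a [b [-> ->]]]]] := germP2 x x'.
by rewrite -rmorphD !germ_invertible; apply: unit_atD.
Qed.

End StalkModUnits.

End Stalks.

Section Integral.
Variables (k : fieldType) (Y : scheme k).
Implicit Types (U V W : opens Y) (x y : Y).

(** The empty family covers an empty open set, so separatedness identifies all sections. *)
Lemma reg_empty U : (forall x, ~ U x) -> forall a b : reg U, a = b.
Proof.
move=> U0 a b; apply: (@reg_separated _ _ U False (fun _ => U)) => //.
  by move=> x /U0.
Qed.

Hypothesis intY : integral_scheme Y.

Lemma integral_unit_neq0 U x (a : reg U) : unit_at x a -> a <> 0.
Proof.
move=> [V [h [Vx [b hb]]]] a0; have [n1 _] := intY.2 V (ex_intro _ x Vx).
by apply: n1; rewrite -hb a0 rmorph0 mul0r.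
Qed.

(** On disjoint [U] and [V] the sections 1 and 0 would glue to an idempotent of the union other than
    0 and 1, impossible in a domain. *)
Lemma integral_irreducible U V : (exists x, U x) -> (exists x, V x) ->
  exists x, U x /\ V x.
Proof.
move=> exU exV; apply: contrapT => nUV.
have disj W : W `<=` U -> W `<=` V -> forall a b : reg W, a = b.
  by move=> hU hV; apply: reg_empty => x Wx; apply: nUV; exists x; split; [apply: hU | apply: hV].
pose W := Opens (openU (oset_open U) (oset_open V)).
pose F (i : bool) := if i then U else V.
have hF i : F i `<=` W by case: i => x; [left | right].
have covF x : W x -> exists i, F i x by case; [exists true | exists false].
pose a (i : bool) : reg (F i) := if i then 1 else 0.
have [|e he] := @reg_glue _ _ W bool F hF covF a.
  by case=> -[] Z hi hj; rewrite /= ?(res_irr hi hj) //; apply: disj.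
have exW : exists x, W x by have [x Ux] := exU; exists x; left.
have [_ dom] := intY.2 W exW.
have : e * (1 - e) = 0.
  apply: (@reg_separated _ Y W bool F hF covF) => i; rewrite rmorphM rmorphB !rmorph1 rmorph0 he.
  by case: (i); rewrite /a ?subrr ?mulr0 ?mul0r.
have [n1U _] := intY.2 U exU; have [n1V _] := intY.2 V exV.
move=> /dom [e0|/eqP]; first by apply: n1U; rewrite -[1](he true) e0 rmorph0.
rewrite subr_eq0 => /eqP e1; apply: n1V.
by rewrite -(rmorph1 (res (hF false))) e1 he.
Qed.

(** By separatedness it is enough to work near each point of [V], where [a] becomes a fraction on an
    affine open that meets [W]. *)
Lemma integral_identity V W (h : W `<=` V) (a : reg V) :
  (exists x, W x) -> res h a = 0 -> a = 0.
Proof.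
move=> exW a0.
suff loc (p : {x | V x}) : exists (D : opens Y) (hD : D `<=` V), D (sval p) /\ res hD a = 0.
  have [D /all_exists [hD Da]] := all_exists loc.
  apply: (@reg_separated _ Y V _ D hD) => [x Vx|p]; last by rewrite rmorph0 (Da p).2.
  by exists (exist _ x Vx); case: (Da (exist _ x Vx)).
case: p => x /= Vx; have [A [Ax affA]] := locally_affine x.
have [b [bV [N [c [ub hc]]]]] := affine_fractions (fun _ : 'I_1 => a) affA Ax Vx.
have Dx : nonvanishing b x by split.
have exD : exists z, nonvanishing b z by exists x.
have [z [Wz Dz]] := integral_irreducible exW exD.
have sub : capo W (nonvanishing b) `<=` A.
  exact: subset_trans (@capr _ _ _) (@nonvanishing_sub _ _ A b).
have [b' [[Az ub'] hb']] := affine_basis affA sub (conj Wz Dz).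
have [_ domA] := intY.2 A (ex_intro _ x Ax).
(* The numerator vanishes on [D(b')], which lies in both [W] and [D(b)], so a power of [b'] kills it
   in the domain [reg A]. *)
have c0 : c ord0 = 0.
  have : res (@nonvanishing_sub _ _ A b') (c ord0) = 0.
    have hb := subset_trans hb' (@capr _ _ _).
    have hW := subset_trans hb' (@capl _ _ _).
    have := congr1 (res hb) (hc ord0); rewrite rmorphM !res_comp.
    rewrite (res_irr (subset_trans hb bV) (subset_trans hW h)) -(res_comp h) a0.
    rewrite rmorph0 mulr0 => ->; exact: res_irr.
  move=> /(affine_ker affA) [n] /domA [] // b0; exfalso.
  by apply: (@integral_unit_neq0 _ z (b' ^+ n)) => //; apply: unit_at_exp.
exists (nonvanishing b), bV; split=> //.
have [_ domD] := intY.2 (nonvanishing b) exD.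
have /domD [b0|//] : res (@nonvanishing_sub _ _ A b) (b ^+ N) * res bV a = 0.
  by rewrite (hc ord0) c0 rmorph0.
exfalso; apply: (@integral_unit_neq0 _ x _ _ b0).
by rewrite unit_at_res //; apply: unit_at_exp.
Qed.

End Integral.

(** * Smooth closed subschemes *)

Section ClosedImmersion.
Variables (k : fieldType) (Y B : scheme k) (i : mor B Y).

Lemma pull_res (V W : opens Y) (h : W `<=` V)
    (h' : mpre i W `<=` mpre i V) (a : reg V) :
  pull i W (res h a) = res h' (pull i V a).
Proof. exact: mor_pull_res. Qed.

Hypothesis immI : closed_immersion i.

Lemma closed_immersion_opens (Z : opens B) (b : B) : Z b ->
  exists V : opens Y, V (i b) /\ mpre i V `<=` Z.
Proof.
have [V eV] := closed_immersion_embed immI Z; rewrite eV => Vb.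
by exists V; split.
Qed.

Variables (V : opens Y) (f : reg V).
Hypothesis idealI : ideal_generated i f.

Lemma ideal_generated_pull : pull i V f = 0.
Proof.
apply/(idealI (@subset_refl _ V)) => y Vy.
exists V, (@subset_refl _ V), 1; split=> //.
by rewrite mul1r !res_id.
Qed.

(** Off the closed image of [i] the function 1 pulls back to a section over the empty set, hence to
    0. So 1 lies in the ideal generated by [f], and [f] is a unit there. *)
Lemma nonunit_in_range y : V y -> ~ unit_at y f -> exists b, i b = y.
Proof.
move=> Vy nf; apply: contrapT => nb; apply: nf.
pose W := capo V (Opens (closed_openC (closed_immersion_closed immI))).
have W1 : pull i W 1 = 0.
  by apply: reg_empty => b [_]; apply; exists b.
have Wy : W y by split=> // -[b _ eb]; apply: nb; exists b.
have [W' [h' [c [W'y e]]]] := (idealI (@capl _ _ _) 1).1 W1 y Wy.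
exists W', (subset_trans h' (@capl _ _ _)); split=> //; exists c.
by rewrite mulrC -res_comp -e rmorph1.
Qed.

(* The stalk of B at b is a quotient of the stalk of Y at i b modulo f ^+ 2, by
   an ideal of square zero. *)
Section StalkPull.
Variables (b : B) (U : opens B) (Vb : V (i b)) (Ub : U b).

Local Notation C := (stalk_mod (f ^+ 2) Vb).
Local Notation C' := (stalk_mod (0 : reg U) Ub).
Local Notation germY := (germ (f ^+ 2) Vb).
Local Notation germB := (germ (0 : reg U) Ub).

Lemma germ_pull_res (W Z : opens Y) (h : Z `<=` W) (Wb : W (i b))
    (Zb : Z (i b)) (a : reg W) :
  germB (Zb : mpre i Z b) (pull i Z (res h a)) =
  germB (Wb : mpre i W b) (pull i W a).
Proof.
have h' : mpre i Z `<=` mpre i W by move=> x; apply: h.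
by rewrite (pull_res _ h') germ_res.
Qed.

Definition stalk_pull (x : C) : C' :=
  germB (predom_pt (repr x) : mpre i (predom (repr x)) b)
    (pull i _ (preval (repr x))).

(** The choice of representative is harmless because [f], and so [f ^+ 2], pulls back to 0. *)
Lemma stalk_pullE (W : opens Y) (Wb : W (i b)) (a : reg W) :
  stalk_pull (germY Wb a) = germB (Wb : mpre i W b) (pull i W a).
Proof.
have /germ_eqP [Z [h [h' [hV [c [Zb e]]]]]] := germ_repr (germY Wb a).
rewrite /stalk_pull -(germ_pull_res h _ Zb) e -(germ_pull_res h' Wb Zb).
rewrite rmorphD rmorphM [pull i Z (res hV _)](pull_res _ (fun x => hV (i x))).
by rewrite [pull i V _]rmorphXn ideal_generated_pull expr0n rmorph0 mulr0 addr0.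
Qed.

Fact stalk_pull_is_zmod : zmod_morphism stalk_pull.
Proof.
move=> x x'; have [W [Wb [a [a' [-> ->]]]]] := germP2 x x'.
by rewrite -rmorphB !stalk_pullE !rmorphB.
Qed.

Fact stalk_pull_is_monoid : monoid_morphism stalk_pull.
Proof.
split=> [|x x']; first by rewrite -(rmorph1 (germY Vb)) stalk_pullE !rmorph1.
have [W [Wb [a [a' [-> ->]]]]] := germP2 x x'.
by rewrite -rmorphM !stalk_pullE !rmorphM.
Qed.

Definition stalk_pull_morphism : {rmorphism C -> C'} :=
  HB.pack stalk_pull
    (GRing.isZmodMorphism.Build C C' stalk_pull stalk_pull_is_zmod)
    (GRing.isMonoidMorphism.Build C C' stalk_pull stalk_pull_is_monoid).

Lemma stalk_pull_surj (x' : C') : exists x, stalk_pull x = x'.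
Proof.
have [Z [Zb [a ->]]] := germP x'.
have [V1 [V1b h]] := closed_immersion_opens Zb.
have [W [h' [a' [Wb _ e]]]] := closed_immersion_surj immI (res h a) V1b.
by exists (germY Wb a'); rewrite stalk_pullE e !germ_res.
Qed.

Lemma stalk_pull_ker (x : C) : stalk_pull x = 0 ->
  exists c, x = c * germY Vb f.
Proof.
have [W [Wb [a ->]]] := germP x; rewrite stalk_pullE -(rmorph0 (germB Ub)).
move=> /germ_eqP [Z [h [h' [h'' [c [Zb]]]]]]; rewrite !rmorph0 mulr0 addr0 => e.
have [V1 [V1b hZ]] := closed_immersion_opens Zb.
(* Over [W1] the function [f] is defined, and the preimage of [W1] lies in [Z], where the pullback
   of [a] vanishes. *)
pose W1 := capo (capo W V) V1.
have hW : W1 `<=` W by move=> ? [[]].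
have hV : W1 `<=` V by move=> ? [[]].
have W1b : W1 (i b) by split.
have p0 : pull i W1 (res hW a) = 0.
  rewrite (pull_res _ (fun x => hW (i x))).
  have hZ' : mpre i W1 `<=` Z by move=> z [_ /hZ].
  by rewrite -[LHS](res_res h hZ') e rmorph0.
have [W2 [h2 [c2 [W2b e2]]]] := (idealI hV _).1 p0 _ W1b.
exists (germY W2b c2); rewrite -(germ_res _ _ (subset_trans h2 hV) _ W2b).
by rewrite -rmorphM -res_comp -e2 /= !germ_res.
Qed.

Lemma germ_square_zero : germY Vb f * germY Vb f = 0.
Proof.
rewrite -rmorphM -(rmorph0 (germY Vb)); apply/germ_eqP.
exists V, (@subset_refl _ V), (@subset_refl _ V), (@subset_refl _ V), 1.
by split=> //; rewrite !res_id add0r mul1r.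
Qed.

Lemma stalk_pull_ker_sq (x x' : C) :
  stalk_pull x = 0 -> stalk_pull x' = 0 -> x * x' = 0.
Proof.
move=> /stalk_pull_ker [c ->] /stalk_pull_ker [c' ->].
by rewrite mulrACA germ_square_zero mulr0.
Qed.

End StalkPull.
End ClosedImmersion.

(** The local heart of the argument: an equation in the square of the maximal ideal cannot cut out a
    smooth subscheme unless it vanishes near [y]. *)
Lemma smooth_ideal_square (k : fieldType) (Y B : scheme k) (i : mor B Y)
    (V : opens Y) (f : reg V) (y : Y) (n : nat) (a c : 'I_n -> reg V) :
  closed_immersion i -> smooth B -> ideal_generated i f -> V y ->
  (forall j, ~ unit_at y (a j)) -> (forall j, ~ unit_at y (c j)) ->
  f = \sum_j a j * c j ->
  exists (Z : opens Y) (h : Z `<=` V), Z y /\ res h f = 0.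
Proof.
move=> immI smB idealI Vy na nc fac.
have nf : ~ unit_at y f.
  by rewrite fac => /(unit_at_sum Vy) [j /unit_atM [/na]].
have [b eb] := nonunit_in_range immI idealI Vy nf.
case: y / eb Vy na nc nf => Vb na nc nf.
have [U [Ub affU [_ fsU]]] := smB b.
have nf2 : ~ unit_at (i b) (f ^+ 2) by rewrite expr2 => /unit_atM [].
pose germY (W : opens Y) (Wb : W (i b)) : {rmorphism reg W -> stalk_mod (f ^+ 2) Vb} :=
  germ (f ^+ 2) Vb Wb.
pose germB (Z : opens B) (Zb : Z b) : {rmorphism reg Z -> stalk_mod (0 : reg U) Ub} :=
  germ (0 : reg U) Ub Zb.
pose q : {rmorphism stalk_mod (f ^+ 2) Vb -> stalk_mod (0 : reg U) Ub} :=
  stalk_pull_morphism idealI Vb Ub.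
pose stC : {rmorphism k -> stalk_mod (f ^+ 2) Vb} :=
  GRing.RMorphism.clone _ _ (germY V Vb \o str V)%FUN _.
pose stC' : {rmorphism k -> stalk_mod (0 : reg U) Ub} :=
  GRing.RMorphism.clone _ _ (germB U Ub \o str U)%FUN _.
have q_surj x' : exists x, q x = x' by exact: (stalk_pull_surj immI idealI).
have q_sq x x' : q x = 0 -> q x' = 0 -> x * x' = 0.
  exact: (stalk_pull_ker_sq immI idealI).
(* The map to lift is the germ map from [reg U] to the stalk of [B]; it is lifted along the
   square-zero surjection [q]. *)
have [e||g [_ qg]] := fsU _ _ stC stC' q (germB U Ub) _ q_surj q_sq _.
- rewrite /= (stalk_pullE idealI).
  by have /= -> := mor_pull_str i V e; apply: germ_str.
- by [].
(* Indexing both families by one finite type yields the same denominator for all of them. *)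
pose x (j : bool * 'I_n) := if j.1 then a j.2 else c j.2.
have [h [hV [N [alpha [uh halpha]]]]] :=
  affine_fractions (fun j => pull i V (x j)) affU Ub (Vb : mpre i V b).
have Db : nonvanishing h b by split.
pose F := germY V Vb f.
have ugh : invertible (g h).
  apply: (invertible_lift q_surj q_sq); rewrite qg.
  by apply/germ_invertible => //; apply: unit_at0.
(* Both sides have the same image under [q], whose kernel consists of multiples of [F]. *)
have lift j : exists e, g (alpha j) = g h ^+ N * germY V Vb (x j) + e * F.
  have q0 : q (g (alpha j) - g h ^+ N * germY V Vb (x j)) = 0.
    rewrite rmorphB rmorphM rmorphXn !qg -rmorphXn /= (stalk_pullE idealI).
    rewrite -(germ_res _ _ (@nonvanishing_sub _ _ U h) _ Db (h ^+ N)).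
    rewrite -(germ_res _ _ (@nonvanishing_sub _ _ U h) _ Db (alpha j)).
    by rewrite -(germ_res _ _ hV _ Db) -rmorphM halpha subrr.
  have [e /eqP] := stalk_pull_ker immI idealI q0.
  by rewrite subr_eq addrC => /eqP ->; exists e.
(* On [D(h)] this sum is [h ^+ N * h ^+ N] times the pullback of [f], hence 0; on the affine [U] a
   power of [h] then kills it. *)
have [p hp] : exists p, h ^+ p * \sum_j alpha (true, j) * alpha (false, j) = 0.
  apply: (affine_ker affU); rewrite rmorph_sum.
  under eq_bigr => j _.
    rewrite rmorphM -!halpha mulrACA -(rmorphM (res hV)) -(rmorphM (pull i V)). over.
  by rewrite -big_distrr -!rmorph_sum /= -fac ideal_generated_pull // rmorph0 mulr0.
have F0 : F = 0.
  have localC := stalk_mod_local (Gy := Vb) nf2.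
  apply: (square_zero_lift (g := g) (a := germY V Vb \o a) (c := germY V Vb \o c)
    localC _ _ _ _ _ ugh (fun j => lift (true, j)) (fun j => lift (false, j)) hp).
  - by rewrite -(rmorph0 (germY V Vb)) germ_invertible //; apply: unit_at0.
  - exact: germ_square_zero.
  - rewrite /F; have -> := congr1 (germY V Vb) fac.
    by rewrite rmorph_sum; apply: eq_bigr => j _; rewrite rmorphM.
  - by move=> j; rewrite germ_invertible.
  - by move=> j; rewrite germ_invertible.
move: F0; rewrite -(rmorph0 (germY V Vb)) => /germ_eqP [Z [h1 [h2 [h3 [c' [Zb e]]]]]].
(* Vanishing modulo [f ^+ 2] means [f = c' * f ^+ 2] near the point, and [1 - c' * f] is a unit
   there because [f] is not. *)
have e1 : (1 - c' * res h1 f) * res h1 f = 0.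
  move: e; rewrite rmorph0 add0r rmorphXn (res_irr h3 h1) => e.
  by rewrite mulrBl mul1r -mulrA -expr2 -e subrr.
have u1 : unit_at (i b) (c' * res h1 f + (1 - c' * res h1 f)).
  by rewrite addrC subrK; apply: unit_at1.
case: (unit_atD Zb u1) => [/unit_atM [_]|[Z' [h' [Z'b u]]]].
  by rewrite unit_at_res.
exists Z', (subset_trans h' h1); split=> //; rewrite -res_comp.
by apply: (invertible_cancel u); rewrite -rmorphM e1 rmorph0.
Qed.

(** * Frames of tensor powers *)

Section Multilinear.
Variables (R : comPzRingType) (A B : lmodType R) (d : nat).
Variables (phi : ('I_d -> A) -> B).
Hypothesis phiM : multilinear phi.

Lemma multilinear0 (l : 'I_d -> A) j : l j = 0 -> phi l = 0.
Proof.
move=> l0; have : phi l = 1 *: phi l + phi l.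
  by apply: (phiM (i := j) (l := l)) => //; rewrite l0 scaler0 addr0.
by rewrite scale1r => /eqP; rewrite -subr_eq subrr eq_sym => /eqP.
Qed.

(** The coordinates are scaled one at a time, along a duplicate-free list of indices. *)
Lemma multilinear_scale (a : 'I_d -> R) (e : 'I_d -> A) :
  phi (fun j => a j *: e j) = (\prod_j a j) *: phi e.
Proof.
pose l (s : seq 'I_d) j := if j \in s then a j *: e j else e j.
suff main s : uniq s -> phi (l s) = (\prod_(j <- s) a j) *: phi e.
  have := main _ (index_enum_uniq _); rewrite -/(index_enum _) => <-.
  by congr phi; apply/funext => j; rewrite /l mem_index_enum.
elim: s => [_|x s IH /= /andP [xs us]]; first by rewrite big_nil scale1r.
rewrite big_cons -scalerA -(IH us).
(* The second summand required by [multilinear] is taken to be zero at [x], so that it contributes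
   nothing. *)
pose l2 j := if j == x then 0 else l s j.
rewrite (phiM (i := x) (l1 := l s) (l2 := l2) (a := a x)); first 1 last.
- by move=> j jx; rewrite /l /l2 inE (negbTE jx).
- by rewrite /l /l2 eqxx addr0 inE eqxx /= (negbTE xs).
by rewrite [phi l2](@multilinear0 _ x) ?addr0 // /l2 eqxx.
Qed.

End Multilinear.

(** When [c] is the coordinate in a frame [e], this form takes the value 1 on the pure tensor of
    copies of [e], and so detects its multiples. *)
Lemma multilinear_prod (R : comPzRingType) (A : lmodType R) (d : nat)
    (c : A -> R) :
  (forall (a : R) (m m' : A), c (a *: m + m') = a * c m + c m') ->
  @multilinear R A R^o d (fun l => \prod_j c (l j)).
Proof.
move=> cL j l l1 l2 a eql lj.
rewrite (bigD1 j) //= [X in _ *: X + _](bigD1 j) //= [X in _ + X](bigD1 j) //=.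
rewrite lj cL /GRing.scale /= mulrDl mulrA; congr (_ * _ + _ * _).
  by apply: eq_bigr => j' /eql [-> _].
by apply: eq_bigr => j' /eql [_ ->].
Qed.

Section Frames.
Variables (k : fieldType) (Y : ringedSpace k).
Implicit Types (L M : modSheaf Y) (U V W : opens Y).

Lemma frame_res L V W (h : W `<=` V) (e : sec L V) : frame e -> frame (mres h e).
Proof.
move=> fe Z hZ; apply: eq_bij (fe Z (subset_trans hZ h)) _ _ => a.
by rewrite (mres_mres _ _ (subset_trans hZ h)).
Qed.

Lemma frame_inj L V (e : sec L V) : frame e -> injective (fun a : reg V => a *: e).
Proof.
move=> fe a b eab; apply: (bij_inj (fe V (@subset_refl _ V))).
by rewrite !mres_id.
Qed.

Lemma frame_surj L V (e : sec L V) (m : sec L V) : frame e -> exists a, m = a *: e.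
Proof.
move=> fe; have [c _ ce] := fe V (@subset_refl _ V).
by exists (c m); have := ce m; rewrite mres_id.
Qed.

Lemma frame_coord L V (e : sec L V) : frame e ->
  exists c : sec L V -> reg V, [/\ forall m, m = c m *: e, c e = 1 &
    forall (a : reg V) m m', c (a *: m + m') = a * c m + c m'].
Proof.
move=> fe; have [c hc] := choice (fun m => frame_surj m fe).
have inj := frame_inj fe.
exists c; split=> //; first by apply: inj; rewrite /= -hc scale1r.
by move=> a m m'; apply: inj; rewrite /= -hc scalerDl -scalerA -!hc.
Qed.

Section TensorPower.
Variables (L M : modSheaf Y) (d : nat) (mu : tensor_map L d M).
Hypothesis powL : is_tensor_power mu.

(** Local injectivity says that locally every multilinear form kills the tensor; the product of
    coordinates sends it to [a]. *)
Lemma tensor_frame_inj V (e : sec L V) (a : reg V) : frame e ->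
  a *: mu V (fun=> e) = 0 -> a = 0.
Proof.
move=> fe a0.
have /(powL.2 V 1 (fun=> a) (fun=> fun=> e)) loc :
  \sum_(j < 1) a *: mu V (fun=> e) = 0 by rewrite big_ord1.
pose I := {x | V x}.
have [Z /all_exists [hZ hb]] := all_exists (fun p : I => loc (sval p) (svalP p)).
apply: (@reg_separated _ Y V _ Z hZ) => [x Vx|p].
  by exists (exist _ x Vx); case: (hb (exist _ x Vx)).
rewrite rmorph0; have [_ H] := hb p.
have [c [_ c1 cL]] := frame_coord (frame_res (hZ p) fe).
have := H _ _ (multilinear_prod (d := d) cL).
rewrite big_ord1 big1 // => <-; exact: esym (mulr1 _).
Qed.

(** Locally [m] is a sum of pure tensors, and expanding them in the frame gives a coefficient.
    Coefficients are unique by [tensor_frame_inj], so they glue. *)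
Lemma tensor_frame_surj V (e : sec L V) (m : sec M V) : frame e ->
  exists a, a *: mu V (fun=> e) = m.
Proof.
move=> fe; pose I := {x | V x}.
have loc (p : I) : exists (Z : opens Y) (h : Z `<=` V) (a : reg Z),
    Z (sval p) /\ mres h m = a *: mu Z (fun=> mres h e).
  have [Z [h [n [a [l [Zp hm]]]]]] := powL.1 V m _ (svalP p).
  have [c [hc _ _]] := frame_coord (frame_res h fe).
  exists Z, h, (\sum_j a j * \prod_i c (l j i)); split=> //; rewrite hm scaler_suml.
  apply: eq_bigr => j _; rewrite -scalerA; congr (_ *: _).
  rewrite -(multilinear_scale (tensor_multilinear mu (U := Z))); congr (mu Z _).
  by apply/funext => i; rewrite -hc.
have [Z /all_exists [hZ /all_exists [b hb]]] := all_exists loc.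
have cov x : V x -> exists p, Z p x.
  by move=> Vx; exists (exist _ x Vx); case: (hb (exist _ x Vx)).
have [|a aP] := @reg_glue _ Y V I Z hZ cov b.
  move=> p q W hp hq; have hW := subset_trans hp (hZ p).
  apply/eqP; rewrite -subr_eq0; apply/eqP.
  apply: (tensor_frame_inj (frame_res hW fe)).
  have eqp r (hr : W `<=` Z r) :
      res hr (b r) *: mu W (fun=> mres hW e) = mres hW m.
    rewrite -(mres_mres (hZ r) hr hW m) (hb r).2 mres_scale tensor_mres.
    by congr (_ *: mu W _); apply/funext => _; rewrite (mres_mres _ _ hW).
  by rewrite scalerBl !eqp subrr.
exists a; apply: (@sec_separated _ _ M V I Z hZ cov) => p.
by rewrite mres_scale aP tensor_mres (hb p).2.
Qed.

Lemma frame_tensor V (e : sec L V) : frame e -> frame (mu V (fun=> e)).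
Proof.
move=> fe W h; rewrite tensor_mres; have feW := frame_res h fe.
have [c hc] := choice (fun m => tensor_frame_surj m feW).
exists c => [a|m] //=; apply/eqP; rewrite -subr_eq0; apply/eqP.
by apply: (tensor_frame_inj feW); rewrite scalerBl hc subrr.
Qed.

End TensorPower.

End Frames.

(** * Vanishing and generation of line bundles, and the theorem *)

(** The coefficient of [s] in any local frame vanishes where the domain of the frame meets [Z],
    which it does by irreducibility, and so vanishes by [integral_identity]. *)
Lemma line_bundle_section_eq0 (k : fieldType) (Y : scheme k) (M : modSheaf Y)
    (s : global_sections M) (Z : opens Y) :
  integral_scheme Y -> line_bundle M -> (exists x, Z x) -> restrict Z s = 0 ->
  s = 0.
Proof.
move=> intY lbM exZ s0.
have [V /all_exists [e he]] := all_exists lbM.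
apply: (@sec_separated _ _ M (whole Y) Y V (fun x => @sub_whole _ (V x))).
  by move=> x _; exists x; case: (he x).
move=> x; case: (he x) => Vx fe; rewrite raddf0.
have [f ef] := frame_surj (mres (@sub_whole _ (V x)) s) fe; rewrite ef.
have exW := integral_irreducible intY exZ (ex_intro (V x) x Vx).
suff -> : f = 0 by rewrite scale0r.
apply: (integral_identity (h := @capr _ Z (V x)) intY exW).
apply: (frame_inj (frame_res (@capr _ Z (V x)) fe)).
rewrite /= scale0r -mres_scale -ef.
rewrite (mres_mres _ _ (@sub_whole _ _)).
by rewrite -(mres_mres (@sub_whole _ Z) (@capl _ Z (V x))) [mres _ s]s0 raddf0.
Qed.

(** A global section with a unit coefficient at [y] is itself a frame near [y] and generates all
    germs there. *)
Lemma not_globally_generated (k : fieldType) (Y : ringedSpace k)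
    (L : modSheaf Y) : line_bundle L -> ~ globally_generated L ->
  exists (y : Y) (V : opens Y) (e : sec L V),
    [/\ V y, frame e & forall (l : global_sections L) (a : reg V),
      restrict V l = a *: e -> ~ unit_at y a].
Proof.
move=> lbL; apply: contra_notP => nex y U m Uy.
have [V [e [Vy fe]]] := lbL y.
apply: contrapT => ngen; apply: nex; exists y, V, e; split=> // l a la.
move=> [Z [h [Zy [b ab]]]]; apply: ngen.
pose W := capo U Z.
have hU : W `<=` U := @capl _ _ _; have hZ : W `<=` Z := @capr _ _ _.
have hV : W `<=` V := subset_trans hZ h.
have [c mc] := frame_surj (mres hU m) (frame_res hV fe).
exists W, hU, 1%N, (fun=> c * res hZ b), (fun=> l); split; first by split.
rewrite big_ord1 mc -scalerA; congr (_ *: _).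
rewrite /restrict -(mres_mres (@sub_whole _ V) hV) [mres _ l]la mres_scale scalerA.
by rewrite -(res_res h hZ hV) -rmorphM mulrC ab rmorph1 scale1r.
Qed.

Theorem proposition4p17 (k : closedFieldType) (char0 : [pchar k] =i pred0)
    (X Y : scheme k) (varX : variety X) (projX : projective X)
    (varY : variety Y) (projY : projective Y)
    (d : nat) (pi : mor X Y)
    (L : modSheaf Y) (lbL : line_bundle L)
    (Ld : modSheaf Y) (mu : tensor_map L d Ld) (powL : is_tensor_power mu)
    (s : global_sections Ld)
    (cover_pi : standard_cyclic_cover pi mu s)
    (mult_s : in_mult_image mu s)
    (B : scheme k) (i : mor B Y) (zeroB : is_zero_scheme s i)
    (smoothB : smooth B) :
  globally_generated L.
Proof.
apply: contrapT => /(not_globally_generated lbL) [y [V [e [Vy fe nonunit]]]].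
have [[sigma [_ _ [x [r [r_lt _]]]]] _ s_neq0 _] := cover_pi.
have [intY _ _] := varY; have [immI ideal_s] := zeroB.
have [n [c [l s_sum]]] := mult_s.
have frLd : line_bundle Ld.
  move=> z; have [W [e' [Wz fe']]] := lbL z.
  by exists W, (mu W (fun=> e')); split=> //; apply: frame_tensor.
have [a la] : exists a, forall j t, restrict V (l j t) = a j t *: e.
  have [co [hco _ _]] := frame_coord fe.
  by exists (fun j t => co (restrict V (l j t))) => j t.
(* Ramification provides [r] with [0 < r < d], which excludes the degrees 0 and 1. *)
case: d => [|[|d]] in mu powL r_lt s s_neq0 frLd ideal_s l s_sum a la cover_pi mult_s zeroB *.
- by case/andP: r_lt.
- by case: r r_lt => [|[|?]].
pose f := \sum_j str V (c j) * \prod_t a j t.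
have sf : restrict V s = f *: mu V (fun=> e).
  rewrite s_sum /restrict raddf_sum /f scaler_suml; apply: eq_bigr => j _.
  rewrite mres_scale res_str tensor_mres -scalerA; congr (_ *: _).
  rewrite -(multilinear_scale (tensor_multilinear mu (U := V))).
  by congr (mu V _); apply/funext => t; apply: la.
(* Each product is split into its first factor and the other [d.+1]. At least one factor remains in
   the second part, so both parts are nonunits at [y]. *)
have [|||Z [h [Zy f0]]] := smooth_ideal_square (n := n)
  (a := fun j => a j ord0)
  (c := fun j => str V (c j) * \prod_(t < d.+1) a j (lift ord0 t))
  immI smoothB (ideal_s _ _ _ (frame_tensor powL fe) sf) Vy.
- by move=> j; apply: nonunit (la _ _).
- move=> j; rewrite big_ord_recl => /unit_atM [_ /unit_atM [+ _]].
  exact: nonunit (la _ _).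
- by apply: eq_bigr => j _; rewrite mulrCA -big_ord_recl.
apply: s_neq0; apply: (line_bundle_section_eq0 intY frLd (Z := Z)); first by exists y.
rewrite /restrict -(mres_mres (@sub_whole _ V) h) [mres _ s]sf mres_scale f0.
by rewrite scale0r.
Qed.
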